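(* Let $\mathcal{H}$ be a complex Hilbert space and let $A\in\mathcal{B}(\mathcal{H})$. Then $$ w^2(A)\geq\frac{1}{4}\|A^*A+AA^*\|+\frac{1}{4}\,\Big|\,\|\Re(A)+\Im(A)\|^2-\|\Re(A)-\Im(A)\|^2\,\Big|. $$
   Context: $\mathcal{B}(\mathcal{H})$ denotes the $C^*$-algebra of bounded linear operators on the complex Hilbert space $\mathcal{H}$, with operator norm $\|\cdot\|$. For $A\in\mathcal{B}(\mathcal{H})$ with adjoint $A^*$: $\Re(A)=\frac{1}{2}(A+A^* )$ and $\Im(A)=\frac{1}{2\mathrm{i}}(A-A^* )$ (self-adjoint operators). The numerical radius is $w(A)=\sup\{|\langle Ax,x\rangle|: x\in\mathcal{H},\ \|x\|=1\}$, and $w^2(A)=(w(A))^2$. *)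

(* Defs.v *)
From HB Require Import structures.
From mathcomp Require Import all_boot all_order all_algebra.
From mathcomp Require Import complex.
From mathcomp Require Import all_classical all_reals all_analysis.

Set Implicit Arguments.
Unset Strict Implicit.
Unset Printing Implicit Defensive.

Import Order.TTheory GRing.Theory Num.Theory.
Import numFieldNormedType.Exports.

Local Open Scope classical_set_scope.
Local Open Scope complex_scope.
Local Open Scope ring_scope.

(* The inner product is linear in its first argument and conjugate-linear in
   the second.  In a normed module over R[i] the norm takes its values in R[i],
   so [inner_norm] is an equation in R[i]. *)
HB.mixin Record isHilbert (R : realType) H of CompleteNormedModule R[i] H := {
  inner : {dot H for (@Num.conj R[i])} ;
  inner_norm : forall x : H, `|x| ^+ 2 = inner x x
}.

#[short(type="hilbertType")]
HB.structure Definition Hilbert (R : realType) :=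
  {H of isHilbert R H & CompleteNormedModule R[i] H}.

Section Operators.
Variables (R : realType) (H : hilbertType R).
Implicit Types (A B : H -> H) (x y z : H).

(* [`|x|] lies in R[i] with zero imaginary part; this is the same number in R,
   where suprema are available. *)
Definition hnorm x : R := complex.Re `|x|.

Definition bounded_operator A : Prop :=
  exists M : R, forall x, hnorm (A x) <= M * hnorm x.

(* For bounded linear A the Riesz representation theorem gives, for each y,
   exactly one such z; the default value 0 is then never used. *)
Definition adjoint A : H -> H :=
  fun y => xget 0 [set z | forall x, inner (A x) y = inner x z].

Definition opnorm A : R := sup [set hnorm (A x) | x in [set x | hnorm x <= 1]].

(* When H = 0 there is no unit vector, and this is [sup set0 = 0]. *)
Definition numerical_radius A : R :=
  sup [set complex.Re `|inner (A x) x| | x in [set x | hnorm x = 1]].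

Definition Re_op A : H -> H := fun x => 2^-1 *: (A x + adjoint A x).

Definition Im_op A : H -> H := fun x => (2 * 'i%C)^-1 *: (A x - adjoint A x).

End Operators.

(* Main.v *)
(* Write [A = B + iC] with [B], [C] the self-adjoint parts and set [S± = B ± C].
   Since [|<A x, x>|^2 = <B x, x>^2 + <C x, x>^2 >= <S± x, x>^2 / 2] and the norm of a
   self-adjoint operator is its numerical radius, [w(A)^2 >= max (|S+|^2, |S-|^2) / 2].
   Now [max (a, b) = (a + b) / 2 + |a - b| / 2], and
   [|S+|^2 + |S-|^2 >= |S+^2 + S-^2| = |A^* A + A A^*|].
   [H] is treated as a real Hilbert space for [rip = Re inner], which has the same
   norm; complex statements are recovered by evaluating at [i x]. *)
Require Import Defs.
From mathcomp Require Import all_boot all_order all_algebra.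
From mathcomp Require Import complex.
From mathcomp Require Import all_classical all_reals all_analysis.
From mathcomp Require Import ring lra.

Import Order.TTheory GRing.Theory Num.Theory.
Import numFieldNormedType.Exports.

Local Open Scope ring_scope.

(** * The real inner product underlying the complex one *)

Section RealInnerProduct.
Set Implicit Arguments.
Unset Strict Implicit.
Variables (R : realType) (H : hilbertType R).
Implicit Types (x y z : H) (t : R).

Definition rip x y : R := complex.Re (inner x y).

Lemma innerC x y : inner x y = Num.conj (inner y x).
Proof. by rewrite hermC expr0 mul1r. Qed.

Lemma ripC x y : rip x y = rip y x.
Proof. by rewrite /rip innerC; case: (inner y x). Qed.

Lemma ripDl x y z : rip (x + y) z = rip x z + rip y z.
Proof. by rewrite /rip linearDl raddfD. Qed.

Lemma ripNl x y : rip (- x) y = - rip x y.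
Proof. by rewrite /rip linearNl raddfN. Qed.

Lemma ripBl x y z : rip (x - y) z = rip x z - rip y z.
Proof. by rewrite ripDl ripNl. Qed.

Lemma ripZl t x y : rip (t%:C%C *: x) y = t * rip x y.
Proof.
rewrite /rip linearZl_LR /=; case: (inner x y) => a b /=.
by rewrite mul0r subr0.
Qed.

Lemma ripDr x y z : rip x (y + z) = rip x y + rip x z.
Proof. by rewrite ripC ripDl !(ripC _ x). Qed.

Lemma ripNr x y : rip x (- y) = - rip x y.
Proof. by rewrite ripC ripNl ripC. Qed.

Lemma ripBr x y z : rip x (y - z) = rip x y - rip x z.
Proof. by rewrite ripDr ripNr. Qed.

Lemma ripZr t x y : rip x (t%:C%C *: y) = t * rip x y.
Proof. by rewrite ripC ripZl ripC. Qed.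

Lemma ripiZl x y : rip ('i%C *: x) y = - complex.Im (inner x y).
Proof.
rewrite /rip linearZl_LR /=; case: (inner x y) => a b /=.
by rewrite mul0r mul1r sub0r.
Qed.

Lemma ripiZr x y : rip x ('i%C *: y) = complex.Im (inner x y).
Proof. by rewrite ripC ripiZl innerC; case: (inner x y) => a b /=; rewrite opprK. Qed.

Lemma normE x : `|x| = (hnorm x)%:C%C.
Proof. by rewrite /hnorm RRe_real// normr_real. Qed.

Lemma hnorm_ge0 x : 0 <= hnorm x.
Proof. by rewrite -ler0c -normE. Qed.

Lemma ripxx x : rip x x = hnorm x ^+ 2.
Proof. by rewrite /rip -inner_norm normE -rmorphXn. Qed.

Lemma hnorm0 : hnorm (0 : H) = 0.
Proof. by rewrite /hnorm normr0. Qed.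

Lemma hnorm0_eq0 x : hnorm x = 0 -> x = 0.
Proof. by move=> x0; apply/eqP; rewrite -normr_eq0 normE x0. Qed.

Lemma hnormZ t x : hnorm (t%:C%C *: x) = `|t| * hnorm x.
Proof.
apply: complexI; rewrite -normE normrZ normE rmorphM; congr (_ * _).
by rewrite normc_def /= expr0n addr0 sqrtr_sqr.
Qed.

(** Cauchy-Schwarz: expanding the squared norm of |y| x - |x| y gives 2 |x| |y| (|x| |y| -
    [rip x y]) >= 0. *)
Lemma rip_le x y : rip x y <= hnorm x * hnorm y.
Proof.
have [/hnorm0_eq0 ->|y0] := eqVneq (hnorm y) 0.
  by rewrite ripC -(scale0r 0) ripZl mul0r mulr_ge0 ?hnorm_ge0.
have yp : 0 < hnorm y by rewrite lt_def y0 hnorm_ge0.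
have [/hnorm0_eq0 ->|x0] := eqVneq (hnorm x) 0.
  by rewrite -(scale0r 0) ripZl mul0r mulr_ge0 ?hnorm_ge0.
have xp : 0 < hnorm x by rewrite lt_def x0 hnorm_ge0.
have := sqr_ge0 (hnorm ((hnorm y)%:C%C *: x - (hnorm x)%:C%C *: y)).
rewrite -ripxx ripBl !ripBr !ripZl !ripZr !ripxx (ripC y x) => h.
have {}h : 0 <= (2 * (hnorm x * hnorm y)) * (hnorm x * hnorm y - rip x y) by lra.
by move: h; rewrite pmulr_rge0 ?subr_ge0// !mulr_gt0.
Qed.

Lemma hnormN x : hnorm (- x) = hnorm x.
Proof. by rewrite /hnorm normrN. Qed.

Lemma ler_norm_rip x y : `|rip x y| <= hnorm x * hnorm y.
Proof. by rewrite ler_norml lerNl -ripNl rip_le -(hnormN x) rip_le. Qed.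

Lemma ripr_inj y z : (forall x, rip x y = rip x z) -> y = z.
Proof.
move=> h; apply/eqP; rewrite -subr_eq0; apply/eqP/hnorm0_eq0/eqP.
by rewrite -sqrf_eq0 -ripxx ripBr h subrr.
Qed.

(** The hypothesis at [x] compares real parts; at i x it compares imaginary parts. *)
Lemma eq_inner_rip (f : {linear H -> H}) y z :
  (forall x, rip (f x) y = rip x z) -> forall x, inner (f x) y = inner x z.
Proof.
move=> h x; have /eqP := h ('i%C *: x).
rewrite linearZ_LR !ripiZl eqr_opp => /eqP; move: (h x); rewrite /rip.
by case: (inner _ _) => a b; case: (inner _ _) => c d /= -> ->.
Qed.

End RealInnerProduct.

(** * Riesz representation of bounded real functionals *)

Section Riesz.
Set Implicit Arguments.
Unset Strict Implicit.
Variables (R : realType) (H : hilbertType R) (f : H -> R) (M : R).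
Hypothesis fD : forall x y : H, f (x + y) = f x + f y.
Hypothesis fZ : forall (t : R) x, f (t%:C%C *: x) = t * f x.
Hypothesis f_le : forall x : H, `|f x| <= M * hnorm x.

(** If z represents [f], then [phi x] = |x - z|^2 - |z|^2, so z is the minimiser of [phi]. *)
Let phi (x : H) : R := hnorm x ^+ 2 - 2 * f x.
Let m : R := inf (range phi).

Let phiD (x h : H) : phi (x + h) = phi x + hnorm h ^+ 2 + 2 * (rip x h - f h).
Proof. by rewrite /phi -!ripxx ripDl !ripDr (ripC h x) fD; ring. Qed.

Let m_le (x : H) : m <= phi x.
Proof.
apply: ge_inf; last by exists x.
(* Completing the square: |y|^2 - 2 M |y| >= - M^2. *)
exists (- M ^+ 2) => _ [y _ <-].
have := f_le y; rewrite /phi ler_norml => /andP[_ fy].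
have := sqr_ge0 (hnorm y - M); rewrite sqrrB.
by move: fy; rewrite mulr2n; lra.
Qed.

(** |x - y|^2 = 2 phi(x) + 2 phi(y) - 4 phi((x + y) / 2), and [phi] is at least [m] at the
    midpoint. *)
Let parallelogram (x y : H) : hnorm (x - y) ^+ 2 <= 2 * (phi x + phi y - 2 * m).
Proof.
have := m_le (2^-1%:C%C *: (x + y)).
rewrite /phi -!ripxx fZ fD ripZl ripZr !(ripDl, ripNl) !(ripDr, ripNr) (ripC y x).
by lra.
Qed.

Let near_min d : 0 < d -> exists x, phi x < m + d.
Proof.
move=> d0; have : m < m + d by rewrite ltrDl.
by case/inf_lt => [|_ [x _ <-] xd]; [exists (phi 0), 0|exists x].
Qed.

Let F : set_system H :=
  filter_from [set d : R | 0 < d] (fun d => [set x | phi x < m + d])%classic.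

Let F_proper : ProperFilter F.
Proof.
apply: filter_from_proper; first apply: filter_from_filter.
- by exists 1 => /=.
- move=> d e /= d0 e0; exists (Num.min d e); first by rewrite /= lt_min d0.
  by move=> x /= xd; split; apply: (lt_le_trans xd);
    rewrite lerD2l ge_min lexx ?orbT.
- by move=> d /= d0; exact: near_min.
Qed.

Let F_cauchy : cauchy F.
Proof.
have FF := F_proper; apply: cauchy_exP => eps eps0.
have epsE : eps = (complex.Re eps)%:C%C by rewrite RRe_real ?gtr0_real.
set e := complex.Re eps in epsE; rewrite epsE; move: eps0; rewrite epsE ltcR => e0.
(* Two points with [phi] below m + d have squared distance below 4 d, which is e^2 / 2 for this
   d. *)
have d0 : 0 < e ^+ 2 / 8 by rewrite divr_gt0 ?exprn_gt0.
have [x xd] := near_min d0.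
exists x; exists (e ^+ 2 / 8) => //= y /= yd.
rewrite -ball_normE /ball_ /= normE ltcR.
rewrite -(ltr_pXn2r (_ : 0 < 2)%N) ?nnegrE ?hnorm_ge0 ?ltW//.
apply: le_lt_trans (parallelogram x y) _.
by have := exprn_gt0 2 e0; lra.
Qed.

(* The representing vector minimises [phi]: a minimising filter is Cauchy by the
   parallelogram law, and at the minimum the derivative in the direction [h],
   which is [2 * (rip z h - f h)], vanishes. *)
Lemma riesz_rip : exists z : H, forall h : H, f h = rip h z.
Proof.
have FF := F_proper; have /cvg_ex [z Fz] : cvg F by exact: (@cauchy_cvg H F FF F_cauchy).
have phiz : phi z <= m.
  apply/ler_addgt0Pr => e e0.
  (* For x within d of z and phi(x) < m + d, [phiD] and Cauchy-Schwarz give phi(z) <= m + d + 2 d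
     (|z| + |M|). *)
  have [d [d0 de]] : exists d : R, 0 < d /\ d * (1 + 2 * (hnorm z + `|M|)) <= e.
    have c0 : 0 < 1 + 2 * (hnorm z + `|M|).
      by rewrite ltr_pwDl// mulr_ge0// addr_ge0 ?hnorm_ge0.
    by exists (e / (1 + 2 * (hnorm z + `|M|))); rewrite divr_gt0// divfK ?gt_eqF.
  have [x [xd zx]] : exists x, phi x < m + d /\ hnorm (x - z) < d.
    have Fd : F [set x | phi x < m + d]%classic by exists d.
    have : F (ball z d%:C%C) by apply: Fz; apply: nbhsx_ballx; rewrite ltcR.
    move=> /(filterI Fd) /filter_ex[x [/= xd zx]]; exists x; split => //.
    by move: zx; rewrite -ball_normE /ball_ /= distrC normE ltcR.
  have := phiD z (x - z); rewrite addrC subrK => phix.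
  have /ler_normlP[rxz _] := ler_norm_rip z (x - z).
  have /ler_normlP[_ fxz] := f_le (x - z).
  have zd : hnorm z * hnorm (x - z) <= hnorm z * d by rewrite ler_wpM2l ?hnorm_ge0// ltW.
  have Md : M * hnorm (x - z) <= `|M| * d.
    by rewrite (le_trans (ler_wpM2r (hnorm_ge0 _) (ler_norm M)))// ler_wpM2l// ltW.
  have := sqr_ge0 (hnorm (x - z)).
  by lra.
exists z => h; rewrite ripC; apply/eqP; rewrite eq_sym -subr_eq0 -sqrf_eq0.
set g := rip z h - f h.
have gt (t : R) : 0 <= t ^+ 2 * hnorm h ^+ 2 + 2 * (t * g).
  have := le_trans phiz (m_le (z + t%:C%C *: h)).
  rewrite phiD hnormZ exprMn real_normK ?num_real// ripZr fZ -mulrBr -/g.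
  by lra.
(* The minimising t would be - g / k; the added 1 keeps the denominator positive when h = 0, and the
   value is still a negative multiple of g^2. *)
have := gt (- g / (hnorm h ^+ 2 + 1)); set k := hnorm h ^+ 2.
have k0 : 0 <= k by exact: sqr_ge0.
have -> : (- g / (k + 1)) ^+ 2 * k + 2 * (- g / (k + 1) * g)
  = - (g ^+ 2 * ((k + 2) / (k + 1) ^+ 2)) by field; lra.
rewrite oppr_ge0 pmulr_lle0 => [g0|]; first by rewrite eq_le g0 sqr_ge0.
by rewrite divr_gt0// ?exprn_gt0//; lra.
Qed.

End Riesz.

(** * Self-adjoint maps and the operator norm *)

Section Operators.
Set Implicit Arguments.
Unset Strict Implicit.
Variables (R : realType) (H : hilbertType R).
Implicit Types x y : H.

(* Polarisation: [4 <S x, y> = <S (x + y), x + y> - <S (x - y), x - y>], which the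
   parallelogram law bounds by [2 c (|x|^2 + |y|^2)]; take [y] to be the multiple of
   [S x] of norm [|x|]. *)
Lemma hnorm_selfadjoint_le (S : H -> H) (c : R) :
  (forall x y, S (x + y) = S x + S y) ->
  (forall x y, rip (S x) y = rip x (S y)) ->
  (forall x, `|rip (S x) x| <= c * hnorm x ^+ 2) ->
  forall x, hnorm (S x) <= c * hnorm x.
Proof.
move=> SD Ssym Sc x.
have S0 : S 0 = 0 by apply: (addrI (S 0)); rewrite -SD !addr0.
have SN y : S (- y) = - S y.
  by apply/eqP; rewrite -addr_eq0 -SD addNr S0.
have polar y : 2 * rip (S x) y <= c * (hnorm x ^+ 2 + hnorm y ^+ 2).
  have /ler_normlP[_ Sp] := Sc (x + y).
  have /ler_normlP[Sm _] := Sc (x - y).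
  move: Sp Sm; rewrite -!ripxx !(SD, SN) !(ripDl, ripNl) !(ripDr, ripNr).
  by rewrite (ripC y x) (ripC (S y) x) -(Ssym x y); lra.
have [/hnorm0_eq0 ->|x0] := eqVneq (hnorm x) 0.
  by rewrite S0 hnorm0 mulr0.
have xp : 0 < hnorm x by rewrite lt_def x0 hnorm_ge0.
have [Sx0|Sx0] := eqVneq (hnorm (S x)) 0.
  rewrite Sx0; have := le_trans (normr_ge0 _) (Sc x).
  by rewrite pmulr_lge0 ?exprn_gt0// => c0; rewrite mulr_ge0// ltW.
have := polar ((hnorm x / hnorm (S x))%:C%C *: S x).
rewrite ripZr ripxx hnormZ ger0_norm ?divr_ge0 ?hnorm_ge0// divfK//.
have -> : hnorm x / hnorm (S x) * hnorm (S x) ^+ 2 = hnorm x * hnorm (S x).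
  by field.
have -> : c * (hnorm x ^+ 2 + hnorm x ^+ 2) = 2 * (hnorm x * (c * hnorm x)) by ring.
by rewrite ler_pM2l// ler_pM2l.
Qed.

Lemma opnorm_le (T : H -> H) (c : R) :
  (forall x, hnorm (T x) <= c * hnorm x) -> 0 <= c -> opnorm T <= c.
Proof.
move=> Tc c0; apply: ge_sup; first by exists (hnorm (T 0)), 0; rewrite //= hnorm0.
by move=> _ [x /= x1 <-]; apply: le_trans (Tc x) _; rewrite ler_piMr.
Qed.

(** The bound [c] makes the supremum finite; real homogeneity reduces to unit vectors. *)
Lemma hnorm_le_opnorm (T : H -> H) (c : R) :
  (forall x, hnorm (T x) <= c * hnorm x) ->
  (forall (t : R) x, T (t%:C%C *: x) = t%:C%C *: T x) ->
  forall x, hnorm (T x) <= opnorm T * hnorm x.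
Proof.
move=> Tc TZ x.
have [x0|x0] := eqVneq (hnorm x) 0.
  by have := Tc x; rewrite x0 !mulr0.
have xp : 0 < hnorm x by rewrite lt_def x0 hnorm_ge0.
rewrite -ler_pdivrMr// mulrC -[_^-1]ger0_norm ?invr_ge0 ?hnorm_ge0//.
rewrite -hnormZ -TZ; apply: ub_le_sup.
  exists `|c| => _ [y /= y1 <-]; apply: le_trans (Tc y) _.
  by rewrite (le_trans (ler_wpM2r (hnorm_ge0 y) (ler_norm c)))// ler_piMr.
exists ((hnorm x)^-1%:C%C *: x) => //=.
by rewrite hnormZ ger0_norm ?invr_ge0 ?hnorm_ge0// mulVf.
Qed.

Lemma opnorm_ge0 (T : H -> H) : 0 <= opnorm T.
Proof.
rewrite /opnorm; set E := [set _ | _ in _]%classic.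
(* Without a finite supremum, [sup E] takes its default value 0. *)
have [[_ uE]|/sup_out ->//] := pselect (has_sup E).
apply: le_trans (hnorm_ge0 (T 0)) _.
by apply: ub_le_sup => //; exists 0; rewrite //= hnorm0.
Qed.

(** * The adjoint of a bounded operator *)

Variable A : {linear H -> H}.
Hypothesis bA : bounded_operator A.

Lemma bounded_operator_ge0 : exists2 M : R, 0 <= M & forall x, hnorm (A x) <= M * hnorm x.
Proof.
have [M AM] := bA; exists `|M| => // x.
by apply: le_trans (AM x) _; rewrite ler_wpM2r ?hnorm_ge0 ?ler_norm.
Qed.

(** Riesz applied to z |-> [rip (A z) y], bounded by M |y|, yields a vector that [eq_inner_rip]
    makes valid for [inner]; hence [xget] does not fall back to 0. *)
Lemma adjointP x y : inner (A x) y = inner x (adjoint A y).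
Proof.
have [M M0 AM] := bounded_operator_ge0.
have [|t z|z|z Az] := @riesz_rip R H (fun z => rip (A z) y) (M * hnorm y).
- by move=> u v; rewrite linearD ripDl.
- by rewrite linearZ_LR ripZl.
- apply: le_trans (ler_norm_rip _ _) _.
  by rewrite mulrAC ler_wpM2r ?hnorm_ge0.
have Aiz := eq_inner_rip Az.
rewrite /adjoint; case: xgetP => [w _ ->//|/(_ z) []] //.
Qed.

Lemma rip_adjoint x y : rip (A x) y = rip x (adjoint A y).
Proof. by rewrite /rip adjointP. Qed.

Lemma adjointD x y : adjoint A (x + y) = adjoint A x + adjoint A y.
Proof.
by apply: ripr_inj => z; rewrite ripDr -!rip_adjoint ripDr.
Qed.

Lemma adjointZ (a : R[i]%C) x : adjoint A (a *: x) = a *: adjoint A x.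
Proof.
apply: ripr_inj => z.
by rewrite /rip -adjointP !linearZr_LR /= adjointP.
Qed.

Lemma inner_adjointl x y : inner (adjoint A x) y = inner x (A y).
Proof. by rewrite innerC -adjointP -innerC. Qed.

Lemma Im_innerC x y : complex.Im (inner x y) = - complex.Im (inner y x).
Proof. by rewrite innerC; case: (inner y x). Qed.

(** * Real and imaginary parts of the operator *)

Lemma rip_Re_op x y : rip (Re_op A x) y = 2^-1 * (rip (A x) y + rip x (A y)).
Proof.
rewrite /Re_op -(rmorph_nat (real_complex R)) -fmorphV ripZl ripDl.
by rewrite {2}/rip inner_adjointl.
Qed.

(** Splits 1 / (2 i) = - i / 2 into a real scalar and i, the two cases that [ripZl] and [ripiZl]
    handle. *)
Lemma Im_opE x : Im_op A x = (- 2^-1)%:C%C *: ('i%C *: (A x - adjoint A x)).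
Proof.
rewrite /Im_op scalerA; congr (_ *: _).
by rewrite complexiE invfM invCi rmorphN fmorphV rmorph_nat mulNr mulrN.
Qed.

Lemma rip_Im_op x y :
  rip (Im_op A x) y = 2^-1 * (complex.Im (inner (A x) y) - complex.Im (inner x (A y))).
Proof.
by rewrite Im_opE ripZl ripiZl linearBl raddfB /= inner_adjointl mulrNN.
Qed.

Lemma rip_Re_op_sym x y : rip (Re_op A x) y = rip x (Re_op A y).
Proof. by rewrite (ripC x) !rip_Re_op (ripC y) (ripC (A y)) addrC. Qed.

Lemma rip_Im_op_sym x y : rip (Im_op A x) y = rip x (Im_op A y).
Proof.
rewrite (ripC x) !rip_Im_op (Im_innerC y) (Im_innerC (A y)).
by congr (_ * _); ring.
Qed.

Lemma Re_opD x y : Re_op A (x + y) = Re_op A x + Re_op A y.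
Proof. by rewrite /Re_op (linearD A) adjointD -scalerDr addrACA. Qed.

Lemma Im_opD x y : Im_op A (x + y) = Im_op A x + Im_op A y.
Proof. by rewrite /Im_op (linearD A) adjointD -scalerDr opprD addrACA. Qed.

Lemma Re_opZ (a : R[i]%C) x : Re_op A (a *: x) = a *: Re_op A x.
Proof. by rewrite /Re_op (linearZ_LR A) adjointZ -scalerDr !scalerA mulrC. Qed.

Lemma Im_opZ (a : R[i]%C) x : Im_op A (a *: x) = a *: Im_op A x.
Proof. by rewrite /Im_op (linearZ_LR A) adjointZ -scalerBr !scalerA mulrC. Qed.

(** * The numerical radius and its quadratic form bound *)

Lemma numerical_radius_ge0 : 0 <= numerical_radius A.
Proof.
rewrite /numerical_radius; set E := [set _ | _ in _]%classic.
(* The default value 0 covers in particular H = 0, where [E] is empty. *)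
have [[[r [x x1 xr]] uE]|/sup_out ->//] := pselect (has_sup E).
apply: (@le_trans _ _ r); last by apply: ub_le_sup => //; exists x.
by rewrite -xr normc_def sqrtr_ge0.
Qed.

(** A crude bound, from |a + i b| <= |a| + |b|, that makes the set defining the numerical radius
    bounded above. *)
Lemma normc_inner_le (M : R) x : (forall x, hnorm (A x) <= M * hnorm x) ->
  complex.Re `|inner (A x) x| <= 2 * M * hnorm x ^+ 2.
Proof.
move=> AM; rewrite normc_def /=.
set a := complex.Re _; set b := complex.Im _.
have [aM bM] : `|a| <= M * hnorm x ^+ 2 /\ `|b| <= M * hnorm x ^+ 2.
  split.
    apply: le_trans (ler_norm_rip (A x) x) _.
    by rewrite expr2 mulrA ler_wpM2r ?hnorm_ge0.
  rewrite /b -ripiZr; apply: le_trans (ler_norm_rip _ _) _.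
  have -> : hnorm ('i%C *: x) = hnorm x.
    by rewrite /hnorm normrZ complexiE normCi mul1r.
  by rewrite expr2 mulrA ler_wpM2r ?hnorm_ge0.
have : Num.sqrt (a ^+ 2 + b ^+ 2) <= `|a| + `|b|.
  rewrite -(ler_pXn2r (_ : 0 < 2)%N) ?nnegrE ?sqrtr_ge0 ?addr_ge0//.
  rewrite sqr_sqrtr ?addr_ge0 ?sqr_ge0// sqrrD !real_normK ?num_real//.
  by rewrite addrAC lerDl mulrn_wge0// mulr_ge0.
by move=> /le_trans; apply; lra.
Qed.

Lemma normc_inner_le_numerical_radius x :
  complex.Re `|inner (A x) x| <= numerical_radius A * hnorm x ^+ 2.
Proof.
have [M M0 AM] := bounded_operator_ge0.
have [/hnorm0_eq0 ->|x0] := eqVneq (hnorm x) 0.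
  by rewrite linear0r normr0 hnorm0 expr0n mulr0.
have xp : 0 < hnorm x by rewrite lt_def x0 hnorm_ge0.
set u := (hnorm x)^-1%:C%C *: x.
have u1 : hnorm u = 1 by rewrite hnormZ ger0_norm ?invr_ge0 ?hnorm_ge0// mulVf.
have xu : x = (hnorm x)%:C%C *: u.
  by rewrite /u scalerA -rmorphM mulfV// scale1r.
have : complex.Re `|inner (A u) u| <= numerical_radius A.
  apply: ub_le_sup; last by exists u.
  exists (2 * M) => _ [y /= y1 <-]; apply: le_trans (normc_inner_le _ AM) _.
  by rewrite y1 expr1n mulr1.
rewrite -(ler_pM2r (_ : 0 < hnorm x ^+ 2)) ?exprn_gt0//; apply: le_trans.
have -> : inner (A x) x
    = (hnorm x)%:C%C * (Num.conj (hnorm x)%:C%C * inner (A u) u).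
  by rewrite {1 2}xu (linearZ_LR A) linearZl_LR linearZr_LR.
have nx : `|(hnorm x)%:C%C| = (hnorm x)%:C%C by rewrite ger0_norm// ler0c ltW.
rewrite !normrM norm_conjC nx; case: `|inner (A u) u| => a b /=.
by rewrite !(mul0r, subr0) mulrA -expr2 mulrC.
Qed.

(* [rip (Re_op A x) x] and [rip (Im_op A x) x] are the real and imaginary parts
   of [inner (A x) x]. *)
Lemma rip_Re_Im_op_le x :
  rip (Re_op A x) x ^+ 2 + rip (Im_op A x) x ^+ 2 <=
  (numerical_radius A * hnorm x ^+ 2) ^+ 2.
Proof.
have -> : rip (Re_op A x) x = complex.Re (inner (A x) x).
  by rewrite rip_Re_op (ripC x) /rip; field.
have -> : rip (Im_op A x) x = complex.Im (inner (A x) x).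
  by rewrite rip_Im_op (Im_innerC x); field.
have := normc_inner_le_numerical_radius x; rewrite normc_def /= => h.
rewrite -[leLHS]sqr_sqrtr ?addr_ge0 ?sqr_ge0//.
by rewrite ler_pXn2r ?nnegrE ?sqrtr_ge0// (le_trans _ h)// sqrtr_ge0.
Qed.

(** From (a + b)^2 <= 2 (a^2 + b^2). *)
Lemma normD_le_sqrt2 (a b r : R) :
  0 <= r -> a ^+ 2 + b ^+ 2 <= r ^+ 2 -> `|a + b| <= Num.sqrt 2 * r.
Proof.
move=> r0 abr; rewrite -ler_sqr ?nnegrE ?mulr_ge0//.
rewrite real_normK ?num_real// exprMn sqr_sqrtr//.
by have := sqr_ge0 (a - b); lra.
Qed.

(** * The sum and difference of the self-adjoint parts *)

Let c := Num.sqrt 2 * numerical_radius A.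

Lemma hnorm_Re_opD_Im_op_le x : hnorm (Re_op A x + Im_op A x) <= c * hnorm x.
Proof.
apply: (hnorm_selfadjoint_le (S := Re_op A \+ Im_op A)) => {x} [x y|x y|x] /=.
- by rewrite Re_opD Im_opD addrACA.
- by rewrite ripDl ripDr rip_Re_op_sym rip_Im_op_sym.
rewrite ripDl -mulrA; apply: normD_le_sqrt2.
  by rewrite mulr_ge0 ?sqr_ge0 ?numerical_radius_ge0.
exact: rip_Re_Im_op_le.
Qed.

Lemma hnorm_Re_opB_Im_op_le x : hnorm (Re_op A x - Im_op A x) <= c * hnorm x.
Proof.
apply: (hnorm_selfadjoint_le (S := Re_op A \- Im_op A)) => {x} [x y|x y|x] /=.
- by rewrite Re_opD Im_opD opprD addrACA.
- by rewrite ripBl ripBr rip_Re_op_sym rip_Im_op_sym.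
rewrite ripBl -mulrA; apply: normD_le_sqrt2.
  by rewrite mulr_ge0 ?sqr_ge0 ?numerical_radius_ge0.
by rewrite sqrrN; exact: rip_Re_Im_op_le.
Qed.

(** The weak form of A^* A + A A^* = S+^2 + S-^2. Both sides equal 2 <B x, B y> + 2 <C x, C y>, as
    the cross terms of S+ and S- cancel. *)
Lemma rip_adjointA_addAadjoint x y :
  rip (adjoint A (A x) + A (adjoint A x)) y =
  rip (Re_op A x + Im_op A x) (Re_op A y + Im_op A y) +
  rip (Re_op A x - Im_op A x) (Re_op A y - Im_op A y).
Proof.
have ReE z : Re_op A z = 2^-1%:C%C *: (A z + adjoint A z).
  by rewrite /Re_op fmorphV rmorph_nat.
have -> : rip (adjoint A (A x) + A (adjoint A x)) y
    = rip (A x) (A y) + rip (adjoint A x) (adjoint A y).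
  by rewrite ripDl -rip_adjoint (ripC (adjoint A _)) -rip_adjoint ripC.
transitivity (2 * rip (Re_op A x) (Re_op A y) + 2 * rip (Im_op A x) (Im_op A y)).
  rewrite !ReE !Im_opE !(ripZl, ripZr).
  (* Multiplication by i preserves [rip], which removes the i from [Im_opE]. *)
  have -> u v : rip ('i%C *: u) ('i%C *: v) = rip u v.
    rewrite ripiZl linearZr_LR /= /rip complexiE conjCi -complexiE.
    by case: (inner u v) => a b /=; ring.
  by rewrite !(ripDl, ripNl) !(ripDr, ripNr); field.
by rewrite !(ripDl, ripNl) !(ripDr, ripNr); ring.
Qed.

End Operators.

(** * The lower bound for the squared numerical radius *)

Theorem theorem2p3 (R : realType) (H : hilbertType R) (A : {linear H -> H})
    (bA : bounded_operator A) :
  numerical_radius A ^+ 2 >=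
    1 / 4 * opnorm ((adjoint A \o A) \+ (A \o adjoint A))
    + 1 / 4 * `| opnorm (Re_op A \+ Im_op A) ^+ 2
                 - opnorm (Re_op A \- Im_op A) ^+ 2 |.
Proof.
have w0 := numerical_radius_ge0 A.
have c0 : 0 <= Num.sqrt 2 * numerical_radius A by rewrite mulr_ge0.
have cE : (Num.sqrt 2 * numerical_radius A) ^+ 2 = 2 * numerical_radius A ^+ 2.
  by rewrite exprMn sqr_sqrtr.
have pc := hnorm_Re_opD_Im_op_le bA; have mc := hnorm_Re_opB_Im_op_le bA.
set p := opnorm (Re_op A \+ Im_op A); set m := opnorm (Re_op A \- Im_op A).
have p0 : 0 <= p := opnorm_ge0 _; have m0 : 0 <= m := opnorm_ge0 _.
have p_c : p ^+ 2 <= 2 * numerical_radius A ^+ 2.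
  by rewrite -cE ler_sqr ?nnegrE//; exact: opnorm_le.
have m_c : m ^+ 2 <= 2 * numerical_radius A ^+ 2.
  by rewrite -cE ler_sqr ?nnegrE//; exact: opnorm_le.
have p_le x : hnorm (Re_op A x + Im_op A x) <= p * hnorm x.
  apply: (hnorm_le_opnorm (T := Re_op A \+ Im_op A) pc) => t y /=.
  by rewrite Re_opZ// Im_opZ// scalerDr.
have m_le x : hnorm (Re_op A x - Im_op A x) <= m * hnorm x.
  apply: (hnorm_le_opnorm (T := Re_op A \- Im_op A) mc) => t y /=.
  by rewrite Re_opZ// Im_opZ// scalerBr.
have T_le : opnorm ((adjoint A \o A) \+ (A \o adjoint A)) <= p ^+ 2 + m ^+ 2.
  apply: opnorm_le => [x /=|]; last by rewrite addr_ge0 ?sqr_ge0.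
  set y := (_ + _).
  have [->|y0] := eqVneq (hnorm y) 0.
    by rewrite mulr_ge0 ?hnorm_ge0// addr_ge0 ?sqr_ge0.
  have yp : 0 < hnorm y by rewrite lt_def y0 hnorm_ge0.
  (* Pairing y with itself: |y|^2 = <S+ x, S+ y> + <S- x, S- y> <= (p^2 + m^2) |x| |y|, with one
     factor |y| to cancel. *)
  rewrite -(ler_pM2r yp) -expr2 -ripxx {1}/y rip_adjointA_addAadjoint//.
  rewrite !mulrDl lerD//; apply: le_trans (rip_le _ _) _.
    by rewrite expr2 (mulrAC p p) -(mulrA (p * _)) ler_pM ?hnorm_ge0.
  by rewrite expr2 (mulrAC m m) -(mulrA (m * _)) ler_pM ?hnorm_ge0.
(* The two signs of the absolute value amount to [p_c] and [m_c]. *)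
have : `|p ^+ 2 - m ^+ 2| <= 4 * numerical_radius A ^+ 2 - (p ^+ 2 + m ^+ 2).
  by rewrite ler_norml; apply/andP; split; lra.
by lra.
Qed.
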